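(* Let $m\geq 1$ and $n\geq 1$ be integers, and let $F_{m,n}=E_m+P_n$ be the generalized fan graph. The complete double vertex graph $M_2(F_{m,n})$ is Hamiltonian if and only if $n\geq 2$ and $1\leq m\leq 2(n-1)$.
   Context: All graphs are simple. For a graph $G$, the complete double vertex graph $M_2(G)$ is the graph whose vertices are all $2$-multisubsets of $V(G)$ (i.e., unordered pairs $\{x,y\}$ with $x,y\in V(G)$, where $x=y$ is allowed), and two such vertices are adjacent if their symmetric difference as multisets is a pair $\{a,b\}$ of vertices with $ab\in E(G)$. For disjoint graphs $G,H$, the join $G+H$ has vertex set $V(G)\cup V(H)$ and edge set $E(G)\cup E(H)\cup\{xy: x\in V(G), y\in V(H)\}$. $E_m$ denotes the edgeless graph on $m$ vertices and $P_n$ the path on $n$ vertices; the generalized fan graph is $F_{m,n}=E_m+P_n$. *)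

(* Defs.v *)
From HB Require Import structures.
From mathcomp Require Import all_boot.
From mathcomp Require Import finmap multiset.

Set Implicit Arguments.
Unset Strict Implicit.
Unset Printing Implicit Defensive.

Local Open Scope mset_scope.

Record sgraph := SGraph {
  vertex :> finType;
  adj : rel vertex;
  adj_sym : symmetric adj;
  adj_irr : irreflexive adj
}.

Definition hamiltonian (G : sgraph) : Prop :=
  exists c : seq G, [/\ 3 <= size c, ucycle (@adj G) c & forall v : G, v \in c].

Section Edgeless.
Variable m : nat.

Definition edgeless_adj : rel 'I_m := fun _ _ => false.

Lemma edgeless_sym : symmetric edgeless_adj. Proof. by []. Qed.

Lemma edgeless_irr : irreflexive edgeless_adj. Proof. by []. Qed.

Definition edgeless_graph : sgraph := SGraph edgeless_sym edgeless_irr.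

End Edgeless.

Section Path.
Variable n : nat.

Definition path_adj : rel 'I_n :=
  fun i j => (i.+1 == j :> nat) || (j.+1 == i :> nat).

Lemma path_sym : symmetric path_adj.
Proof. by move=> i j; rewrite /path_adj orbC. Qed.

Lemma path_irr : irreflexive path_adj.
Proof. by move=> i; rewrite /path_adj orbb gtn_eqF. Qed.

Definition path_graph : sgraph := SGraph path_sym path_irr.

End Path.

Section Join.
Variables G H : sgraph.

Definition join_adj : rel (G + H)%type := fun u v =>
  match u, v with
  | inl x, inl y => adj x y
  | inr x, inr y => adj x y
  | _, _ => true
  end.

Lemma join_sym : symmetric join_adj.
Proof. by move=> [x|x] [y|y] //=; rewrite adj_sym. Qed.

Lemma join_irr : irreflexive join_adj.
Proof. by move=> [x|x] /=; rewrite adj_irr. Qed.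

Definition join_graph : sgraph := SGraph join_sym join_irr.

End Join.

Definition fan_graph (m n : nat) : sgraph :=
  join_graph (edgeless_graph m) (path_graph n).

Definition msymdiff (T : choiceType) (A B : {mset T}) : {mset T} :=
  (A `\` B) `+` (B `\` A).

(* [size A] counts the elements of [A] with multiplicity. *)
Record mset2 (T : choiceType) := MSet2 {
  mset2_val :> {mset T};
  _ : size mset2_val == 2
}.

HB.instance Definition _ (T : choiceType) := [isSub for @mset2_val T].
HB.instance Definition _ (T : choiceType) := [Choice of mset2 T by <:].

Section Mset2Finite.
Variable T : finType.

Definition mset2_code (A : mset2 T) : 2.-tuple T := Tuple (valP A).

Definition mset2_decode (t : 2.-tuple T) : option (mset2 T) :=
  insub (seq_mset t : {mset T}).

Lemma mset2_codeK : pcancel mset2_code mset2_decode.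
Proof. by move=> A; rewrite /mset2_decode /= seq_mset_id valK. Qed.

HB.instance Definition _ := PCanIsCountable mset2_codeK.
HB.instance Definition _ : isFinite (mset2 T) := PCanIsFinite mset2_codeK.

End Mset2Finite.

Section CompleteDoubleVertexGraph.
Variable G : sgraph.

Definition complete_double_adj : rel (mset2 G) := fun A B =>
  [exists a : G, exists b : G, adj a b && (msymdiff A B == [mset a; b])].

Lemma complete_double_sym : symmetric complete_double_adj.
Proof.
by move=> A B; rewrite /complete_double_adj /msymdiff msetDC.
Qed.

Lemma complete_double_irr : irreflexive complete_double_adj.
Proof.
move=> A; apply/negbTE/existsP=> -[a /existsP[b /andP[_ /eqP E]]].
have /msetP/(_ a) := E.
by rewrite /msymdiff !msetE2 subnn !msetnE eqxx.
Qed.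

Definition complete_double_vertex_graph : sgraph :=
  SGraph complete_double_sym complete_double_irr.

End CompleteDoubleVertexGraph.

(* Main.v *)
Require Import Defs.
From mathcomp Require Import all_boot zify finmap multiset.

(** Write [w_i] for the vertices of [E_m] and [p_a] for those of [P_n].

    Necessity. The pairs [{w_i, w_j}] form an independent set of size
    [m (m + 1) / 2] whose neighbours are among the [m n] pairs [{w_i, p_a}], and
    no [{p_a, p_b}] is adjacent to a [{w_i, w_j}]. Along a Hamiltonian cycle the
    successor map injects the pairs [{w_i, w_j}] into the pairs [{w_i, p_a}],
    and also sends some [{p_a, p_b}] there, so [m (m + 1) / 2 + 1 <= m n].

    Sufficiency. For [m = 1] a cycle visits the rows [{p_a, p_b}], [a <= b], two
    at a time (one upwards, the next downwards), moving from one pair of rows to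
    the next through [{w_0, p_a}], and closes through [{w_0, w_0}]. For each
    [0 < j < m], a block is then spliced in: the connector [{w_j-1, w_j}]
    followed by the path [{w_j, p_0}, ..., {w_j, p_n-1}], which has [n - 1] gaps
    into each of which any pair [{w_i, w_j}] fits. The pair [{w_i, w_j}],
    [i <= j], goes to block [j], except when [0 < i] and [i + n - 1 <= j], in
    which case it goes to block [i]; the bound [m <= 2 (n - 1)] is exactly what
    makes every block large enough. *)

Set Implicit Arguments.
Unset Strict Implicit.
Unset Printing Implicit Defensive.

(** * Two-element multisets as unordered pairs *)

Lemma size_seq_mset2 (T : choiceType) (x y : T) :
  size (seq_mset [:: x; y]) == 2.
Proof. by rewrite (perm_size (perm_eq_seq_mset _)). Qed.

Definition mpair (T : choiceType) (x y : T) : mset2 T :=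
  MSet2 (size_seq_mset2 x y).

Section Mpair.
Variable T : choiceType.
Implicit Types x y z : T.

Lemma mpairE x y z : mset2_val (mpair x y) z = (x == z) + (y == z).
Proof. by rewrite /= mset_seqE /= addn0. Qed.

Lemma mpairC x y : mpair x y = mpair y x.
Proof. by apply/val_inj/msetP => z; rewrite !mpairE addnC. Qed.

Lemma mpairP (A : mset2 T) : exists x y, A = mpair x y.
Proof.
have := valP A; rewrite /=; case E: (enum_mset A) => [|x [|y []]] // _.
exists x, y; apply: val_inj; rewrite /= -[LHS]seq_mset_id E; exact: erefl.
Qed.

Lemma mpair_inj x y x' y' : mpair x y = mpair x' y' ->
  (x = x' /\ y = y') \/ (x = y' /\ y = x').
Proof.
move=> /(congr1 val) /= /eq_seq_msetP.
have [->|neq] := eqVneq x x'.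
  by rewrite perm_cons => /perm_mem /(_ y); rewrite !inE eqxx => /esym /eqP; left.
move=> p; have := perm_mem p x; rewrite !inE eqxx (negPf neq) /= => /esym /eqP xy'.
right; split=> //; move: p; rewrite xy' perm_sym (perm_catC [:: x'] [:: y']) perm_cons perm_sym.
by move=> /perm_mem /(_ y); rewrite !inE eqxx => /esym /eqP.
Qed.

End Mpair.

(** * Adjacency between pairs *)

Section DoubleAdj.
Variable G : sgraph.
Local Notation M2 := (complete_double_vertex_graph G).
Implicit Types x y z : G.

Lemma adj_neq x y : adj x y -> x != y.
Proof. by apply: contraTneq => ->; rewrite adj_irr. Qed.

Lemma adj_mpair x y z : adj y z -> @adj M2 (mpair x y) (mpair x z).
Proof.
move=> yz; apply/existsP; exists y; apply/existsP; exists z; rewrite yz /=.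
apply/eqP/msetP => t; have : ~~ ((t == y) && (t == z)).
  by apply: contra (adj_neq yz) => /andP[/eqP<- /eqP<-].
rewrite /msymdiff !msetE2 !msetnE !mset_seqE /=.
by rewrite ![_ == t]eq_sym; case: (t == x); case: (t == y); case: (t == z).
Qed.

(** The two multiplicity functions are compared pointwise: a shared element cancels, and two pairs
    with no shared element have too large a symmetric difference. *)
Lemma adj_mpairP (A B : M2) :
  @adj M2 A B -> exists x y z, [/\ A = mpair x y, B = mpair x z & adj y z].
Proof.
move=> /existsP[a /existsP[b /andP[ab /eqP/msetP AB]]].
have [x [y AE]] := mpairP A; have [x' [z BE]] := mpairP B.
have E t : ((x == t) + (y == t) - ((x' == t) + (z == t))) +
  (((x' == t) + (z == t) - ((x == t) + (y == t)))) = (a == t) + (b == t).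
  have := AB t; rewrite /msymdiff !msetE2 !msetnE AE BE !mpairE.
  by rewrite [t == a]eq_sym [t == b]eq_sym; do 2!case: eqP.
(* Evaluating at [a] and at [b] identifies [{u, v}] with [{a, b}]. *)
have adjE u v : (forall t, ((u == t) - (v == t)) + ((v == t) - (u == t))
    = (a == t) + (b == t)) -> adj u v.
  move=> uvE; have nab := negPf (adj_neq ab).
  move: (uvE a) (uvE b); rewrite !eqxx [b == a]eq_sym nab.
  have [->|_] := eqVneq u a; have [->|_] := eqVneq v a => //= _.
    by rewrite nab; have [->|] := eqVneq v b.
  by rewrite nab; have [->|] := eqVneq u b => //; rewrite adj_sym.
have [xx'|xx'] := eqVneq x x'.
  exists x, y, z; rewrite AE BE xx'; split=> //; apply: adjE => t.
  by rewrite -E xx'; do 3!case: (_ == t).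
have [xz|xz] := eqVneq x z.
  exists x, y, x'; rewrite AE BE xz (mpairC x'); split=> //; apply: adjE => t.
  by rewrite -E xz; do 3!case: (_ == t).
have [yx'|yx'] := eqVneq y x'.
  exists y, x, z; rewrite AE BE yx' (mpairC x); split=> //; apply: adjE => t.
  by rewrite -E yx'; do 3!case: (_ == t).
have [yz|yz] := eqVneq y z.
  exists y, x, x'; rewrite AE BE yz (mpairC x) (mpairC x'); split=> //; apply: adjE => t.
  by rewrite -E yz; do 3!case: (_ == t).
have := E x; have := E y; have := E x'; have := E z; rewrite !eqxx.
rewrite ![z == _]eq_sym ![x' == _]eq_sym !(negPf xx', negPf xz, negPf yx', negPf yz).
move=> Ez _ Ey Ex.
(* With no shared element, [x] and [y] already use up [a] and [b], so nothing is left to account for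
   [z]. *)
suff [[ax by']|[bx ay]] : (a = x /\ b = y) \/ (b = x /\ a = y).
- by move: Ez; rewrite ax by' (negPf xz) (negPf yz); case: (_ == _).
- by move: Ez; rewrite bx ay (negPf xz) (negPf yz); case: (_ == _).
move: Ex Ey; have [ax _|_] := eqVneq a x.
  by rewrite -ax; case: (a == y) => /= -[] /esym; case: eqP; left.
have [<-|_] := eqVneq b x; last by case: (_ == _).
by move=> _; case: (b == y) => /= -[]; case: eqP; right.
Qed.
End DoubleAdj.

(** * Inserting elements into the gaps of a path *)

Section Interleave.
Variables (T : eqType) (e : rel T).

Fixpoint interleave (s l : seq T) : seq T :=
  match s, l with
  | y :: s', x :: l' => y :: x :: interleave s' l'
  | _, _ => l
  end.

Lemma perm_interleave s l :
  size s <= size l -> perm_eq (interleave s l) (s ++ l).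
Proof.
elim: s l => [|y s IHs] [|x l] //= le_sl.
rewrite perm_cons perm_sym -cat1s perm_catCA cat1s perm_cons perm_sym.
exact: IHs.
Qed.

Lemma last_interleave x s l : last x (interleave s l) = last x l.
Proof. by elim: s x l => [|y s IHs] x [|x' l] //=. Qed.

(** An element adjacent to every vertex of the path fits into any gap; keeping [x] outside [l] makes
    the gap before the head of [l] available. *)
Lemma path_interleave x s l :
    {in x :: l & s, forall u v, e u v && e v u} ->
  path e x l -> path e x (interleave s l).
Proof.
elim: s x l => [|y s IHs] x [|x' l] //= es /andP[_ pl].
have /andP[-> _] := es x y (mem_head _ _) (mem_head _ _).
have /andP[_ ->] /= : e x' y && e y x'.
  by apply: es; rewrite ?inE eqxx ?orbT.
by apply: IHs => // u v ul vs; apply: es; rewrite inE ?ul ?vs orbT.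
Qed.

End Interleave.

(** [f] recovers the index from an entry, so lists with different indices are disjoint. *)
Lemma uniq_flatten_map (I T : eqType) (F : I -> seq T) (f : T -> I) (s : seq I) :
    uniq s -> {in s, forall i, uniq (F i)} ->
    {in s, forall i, {in F i, forall x, f x = i}} ->
  uniq (flatten [seq F i | i <- s]).
Proof.
elim: s => //= i s IHs /andP[i_s us] uF fF.
rewrite cat_uniq uF ?mem_head //= IHs //; first last.
- by move=> j js; apply: fF; rewrite inE js orbT.
- by move=> j js; apply: uF; rewrite inE js orbT.
rewrite andbT; apply/hasPn => x /flatten_mapP[j js xj]; apply/negP => xi.
have := fF i (mem_head _ _) x xi; rewrite (fF j _ x xj) ?inE ?js ?orbT //.
by move=> ji; rewrite -ji js in i_s.
Qed.

(* [x < n] encodes the path vertex [x] and [n + i] the [i]-th vertex of the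
   edgeless part; a 2-multiset is encoded by a pair [(x, y)] with [x <= y]. *)
Definition code_adj n x y :=
  [|| (x < n) && (n <= y), (y < n) && (n <= x)
    | [&& x < n, y < n & (x.+1 == y) || (y.+1 == x)]].

Definition pair_adj n : rel (nat * nat) := fun u v =>
  [|| (u.1 == v.1) && code_adj n u.2 v.2, (u.1 == v.2) && code_adj n u.2 v.1,
      (u.2 == v.1) && code_adj n u.1 v.2 | (u.2 == v.2) && code_adj n u.1 v.1].

(** * The cycle on codes: the spine, which settles [m = 1] *)

Section FanCycle.
Variable n : nat.

Local Notation row a s := [seq (a, b) | b <- s].

Lemma mem_row (a : nat) (s : seq nat) x y : ((x, y) \in row a s) = (x == a) && (y \in s).
Proof.
apply/mapP/andP => [[b bs [-> ->]]|[/eqP-> ys]]; first by rewrite eqxx.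
by exists y.
Qed.

(** One step runs up row [k'.+1] and down row [k'], then leaves through [(k', n)]. For even [k] the
    pair [(n, n)] ends the list; for odd [k] it precedes the lone row [0]. *)
Fixpoint spine k : seq (nat * nat) :=
  match k with
  | 0 => [:: (n, n)]
  | 1 => (n, n) :: (0, n) :: row 0 (iota 0 n)
  | k'.+2 => (k'.+1, n) :: row k'.+1 (iota k'.+1 (n - k'.+1))
             ++ row k' (rev (iota k' (n - k'))) ++ (k', n) :: spine k'
  end.

Lemma nat_ind2 (P : nat -> Prop) :
  P 0 -> P 1 -> (forall k, P k -> P k.+2) -> forall k, P k.
Proof.
move=> P0 P1 PS k; suff: P k /\ P k.+1 by case.
by elim: k => // k [Pk PSk]; split=> //; apply: PS.
Qed.

Lemma mem_spine k x y :
  k <= n -> ((x, y) \in spine k) = ((x, y) == (n, n)) || (x < k) && (x <= y <= n).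
Proof.
elim/nat_ind2: k => [||k IHk] le_kn.
- by rewrite !inE orbF.
- by rewrite /= !inE mem_row mem_iota !xpair_eqE; lia.
rewrite /= inE !mem_cat inE !mem_row mem_rev !mem_iota IHk ?xpair_eqE; lia.
Qed.

Lemma uniq_spine k : k <= n -> uniq (spine k).
Proof.
have uR (a : nat) (s : seq nat) : uniq s -> uniq (row a s).
  by move=> us; rewrite map_inj_uniq // => ? ? [].
elim/nat_ind2: k => [//||k IHk] le_kn.
  by rewrite /= !inE !mem_row uR ?iota_uniq // mem_iota xpair_eqE; lia.
rewrite /= !cat_uniq /= mem_cat mem_cat inE !mem_row mem_rev !mem_iota.
rewrite !uR ?rev_uniq ?iota_uniq ?IHk ?has_cat ?mem_spine ?xpair_eqE /=; try lia.
rewrite !mem_row ?mem_rev ?mem_iota.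
have -> : has (in_mem^~ (mem (row k.+1 (iota k.+1 (n - k.+1)))))
   (row k (rev (iota k (n - k)))) = false.
  by apply/hasPn => -[x y]; rewrite !mem_row => /andP[/eqP-> _]; lia.
have -> : has (in_mem^~ (mem (row k.+1 (iota k.+1 (n - k.+1))))) (spine k) = false.
  by apply/hasPn => -[x y]; rewrite !mem_row mem_spine ?mem_iota ?xpair_eqE; lia.
have -> : has (in_mem^~ (mem (row k (rev (iota k (n - k)))))) (spine k) = false.
  by apply/hasPn => -[x y]; rewrite !mem_row mem_rev mem_spine ?mem_iota ?xpair_eqE; lia.
lia.
Qed.

Lemma path_row (a b l : nat) : b + l < n ->
  path (pair_adj n) (a, b) (row a (iota b.+1 l)).
Proof.
elim: l b => //= l IHl b lt_bn; rewrite IHl; last by lia.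
rewrite andbT /pair_adj /code_adj /=; lia.
Qed.

Lemma last_row (a b l : nat) : last (a, b) (row a (iota b.+1 l)) = (a, b + l).
Proof. by elim: l b => [|l IHl] b /=; rewrite ?addn0 // IHl addnS. Qed.

Lemma rev_iotaS b l : rev (iota b l.+1) = (b + l) :: rev (iota b l).
Proof. by rewrite -addn1 iotaD rev_cat. Qed.

Lemma path_rev_row (a b l : nat) : b + l < n ->
  path (pair_adj n) (a, b + l) (row a (rev (iota b l))).
Proof.
elim: l => //= l IHl lt_bn; rewrite rev_iotaS /= IHl; last by lia.
rewrite andbT /pair_adj /code_adj /=; lia.
Qed.

Lemma last_rev_row (a b l : nat) : last (a, b + l) (row a (rev (iota b l))) = (a, b).
Proof. by elim: l => [|l IHl]; rewrite ?addn0 // rev_iotaS /=. Qed.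

(** The start [(k, n)] is the entry that precedes [spine k] inside [spine k.+2]. *)
Lemma path_spine k : k < n -> path (pair_adj n) (k, n) (spine k).
Proof.
elim/nat_ind2: k => [||k IHk] lt_kn /=.
- by rewrite /pair_adj /code_adj /=; lia.
- have -> : iota 0 n = 0 :: iota 1 n.-1 by case: n lt_kn.
  rewrite /= path_row; last by lia.
  rewrite /pair_adj /code_adj /=; lia.
have [l nE] : exists l, n = k.+1 + l.+1 by exists (n - k.+2); lia.
have -> : n - k.+1 = l.+1 by lia.
have -> : n - k = l.+2 by lia.
rewrite rev_iotaS /= !cat_path /= last_row !cat_path /= last_rev_row.
rewrite path_row ?path_rev_row ?IHk; try lia.
rewrite /pair_adj /code_adj /=; lia.
Qed.

(** The cases are [k] even and [k] odd. Both endings are adjacent to [(n.-1, n)], which comes next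
    after the rotation. *)
Lemma last_spine k x : last x (spine k) = (n, n) \/
  last x (spine k) = (0, n.-1).
Proof.
elim/nat_ind2: k x => [||k IHk] x /=; first by left.
  right; case: n => [|n']; [|by rewrite /= last_row].
  done.
by rewrite !last_cat /=; apply: IHk.
Qed.

(** * Blocks for the remaining edgeless vertices *)

Variable m : nat.

(* For [y <= n], where the pair lies in no block, this is [0]. *)
Definition owner (u : nat * nat) :=
  if (n < u.1) && (u.1 + n - 1 <= u.2) then u.1 - n else u.2 - n.

(* The second list is empty, by truncated subtraction, when [m <= j + n - 1]. *)
Definition extra j :=
  let a := maxn 1 (j + 2 - n) in
  [seq (n + i, n + j) | i <- j :: nseq (1 < j) 0 ++ iota a (j - 1 - a)]
  ++ [seq (n + j, n + k) | k <- iota (j + n - 1) (m - (j + n - 1))].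

Definition block j :=
  [:: (n + j - 1, n + j), (0, n + j)
    & interleave (extra j) [seq (a, n + j) | a <- iota 1 n.-1]].

(** The rotation puts [(n - 1, n)] last, where the first block can be entered; the final vertex
    [(n - 1, n + m - 1)] is adjacent to the new head [(n - 1, n - 1)]. *)
Definition fan_cycle :=
  rot 1 (spine n) ++ flatten [seq block j | j <- iota 1 m.-1].

Hypotheses (n_gt1 : 1 < n) (m_gt0 : 0 < m) (le_mn : m <= 2 * (n - 1)).

Lemma mem_col (f : nat -> nat) (y : nat) s u v :
  injective f -> ((f u, v) \in [seq (f i, y) | i <- s]) = (u \in s) && (v == y).
Proof.
move=> f_inj; apply/mapP/andP => [[i si [/f_inj-> ->]]|[us /eqP->]] //.
by exists u.
Qed.

(** If [j < n], the two lists have [j] and at most [n - 1 - j] entries, by the bound on [m]; if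
    [n <= j], they have [n - 1] and none. *)
Lemma size_extra j : 0 < j < m -> size (extra j) <= n.-1.
Proof.
move=> jm; rewrite /extra size_cat !size_map /= size_cat size_nseq !size_iota.
case: (1 < j) (ltnP 1 j) => -[] //; lia.
Qed.

(** The excluded pair is the connector, which also has owner [j] but heads the block. *)
Lemma mem_extra j (x y : nat) : 0 < j < m ->
  ((x, y) \in extra j) = [&& n <= x, x <= y, y < n + m, owner (x, y) == j
                          & ((x, y) != (n + j - 1, n + j))].
Proof.
move=> jm; have [lt_xn|le_nx] := ltnP x n.
  rewrite mem_cat; apply/negbTE; rewrite negb_or.
  by apply/andP; split; apply/mapP => -[i _ [xE _]]; lia.
have [i xE] : exists i, x = n + i by exists (x - n); lia.
rewrite xE mem_cat mem_col; last by move=> ? ?; lia.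
have -> : ((n + i, y) \in [seq (n + j, n + k)
            | k <- iota (j + n - 1) (m - (j + n - 1))])
   = [&& i == j, j + n - 1 + n <= y & y < n + m].
  apply/mapP/and3P => [[k + [? ->]]|[/eqP-> ? ?]].
    by rewrite mem_iota => ?; split; lia.
  by exists (y - n); rewrite ?mem_iota; [lia | congr pair; lia].
rewrite !inE mem_cat mem_nseq mem_iota lt0b /owner xpair_eqE /=.
have -> : (maxn 1 (j + 2 - n) <= i < maxn 1 (j + 2 - n) + (j - 1 - maxn 1 (j + 2 - n)))
  = [&& 0 < i, j + 2 <= n + i & i.+1 < j] by lia.
by have [?|?] := leqP (n + i + n - 1) y; [have [?|?] := ltnP n (n + i)|];
  rewrite /= ?andbF; apply/idP/idP; lia.
Qed.

Lemma uniq_extra j : 0 < j < m -> uniq (extra j).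
Proof.
move=> jm; rewrite cat_uniq !map_inj_uniq; try by move=> ? ? []; lia.
rewrite iota_uniq andbT /= mem_cat mem_nseq mem_iota cat_uniq iota_uniq.
have -> : uniq (nseq (1 < j) 0) by case: (1 < j).
rewrite !andbT -!all_predC lt0b -andbA; apply/and3P; split; first by lia.
- by apply/allP => i; rewrite mem_iota /= mem_nseq; lia.
- apply/allP => u /mapP[k]; rewrite mem_iota => kP ->.
  by rewrite /= -map_cons mem_col; [lia | move=> ? ?; lia].
Qed.

Lemma perm_block j : 0 < j < m ->
  perm_eq (block j) [:: (n + j - 1, n + j), (0, n + j)
    & extra j ++ [seq (a, n + j) | a <- iota 1 n.-1]].
Proof.
move=> jm; rewrite /block !perm_cons.
by apply: perm_interleave; rewrite size_map size_iota; apply: size_extra.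
Qed.

(** The blocks are fibres of [owner], so they are disjoint and together hold exactly the codes
    missing from the spine. *)
Lemma mem_block j (x y : nat) : 0 < j < m ->
  ((x, y) \in block j) = [&& x <= y, n < y, y < n + m & owner (x, y) == j].
Proof.
move=> jm; rewrite (perm_mem (perm_block jm)) 2!in_cons mem_cat mem_extra //.
by rewrite (mem_col (f := id)) // mem_iota /owner !xpair_eqE /=; case: ifP; lia.
Qed.

Lemma uniq_block j : 0 < j < m -> uniq (block j).
Proof.
move=> jm; rewrite (perm_uniq (perm_block jm)).
have := uniq_extra jm; have: (forall x y, _) := fun x y => mem_extra x y jm.
move: (extra j) => s mem_s uniq_s; rewrite /= in_cons !mem_cat !mem_s.
rewrite !(mem_col (f := id)) // !mem_iota !xpair_eqE cat_uniq uniq_s.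
rewrite map_inj_uniq ?iota_uniq; last by move=> ? ? [].
rewrite andbT /= -all_predC; apply/and3P; split; [lia | lia |].
apply/allP => u /mapP[a]; rewrite mem_iota => aP ->.
by rewrite /= mem_s; lia.
Qed.

Lemma last_block x j : last x (block j) = (n.-1, n + j).
Proof.
rewrite 2!last_cons last_interleave (last_map (fun a => (a, n + j)) _ 0).
by rewrite -nth_last size_iota nth_iota; [congr pair; lia | lia].
Qed.

Lemma path_block j : 0 < j < m ->
  path (pair_adj n) (n.-1, n + j - 1) (block j).
Proof.
move=> jm; have mem_s (x y : nat) := mem_extra x y jm.
rewrite /block; move: (extra j) mem_s => s mem_s; rewrite /= path_interleave.
- by rewrite /pair_adj /code_adj /=; lia.
- move=> [a b] [x y].
  rewrite -[_ :: _]/[seq (a, n + j) | a <- 0 :: iota 1 n.-1].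
  rewrite (mem_col (f := id)) // mem_s inE mem_iota /owner.
  move=> /andP[an /eqP->] /and5P[nx xy _ /eqP/= own _].
  have {}an : a < n by lia.
  (* Owner [j] forces [n + j] into the inserted pair; its other member is at least [n], hence
     adjacent to the path vertex [a]. *)
  have [->|->] : x = n + j \/ y = n + j by case: ifP own; lia.
    by rewrite /pair_adj /code_adj /= eqxx an (leq_trans nx xy) !orbT.
  by rewrite /pair_adj /code_adj /= eqxx an nx !orbT.
- have: n.-1 + 0 < n by lia.
  elim: (n.-1) 0 => //= l IHl a lt_ln; rewrite IHl ?andbT; last by lia.
  by rewrite /pair_adj /code_adj /=; lia.
Qed.

(** The endpoint is carried along because block [j] is entered from the last vertex of block
    [j - 1], or from [(n - 1, n)] when [j = 1]. *)
Lemma path_blocks j k : 0 < j -> j + k <= m ->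
  path (pair_adj n) (n.-1, n + j - 1) (flatten [seq block i | i <- iota j k])
  /\ last (n.-1, n + j - 1) (flatten [seq block i | i <- iota j k])
     = (n.-1, n + j + k - 1).
Proof.
elim: k j => [|k IHk] j j_gt0 jkm; first by rewrite addn0.
have [pk lk] := IHk j.+1 isT ltac:(lia).
have jE : n + j.+1 - 1 = n + j by lia.
rewrite -[flatten _]/(block j ++ flatten [seq block i | i <- iota j.+1 k]).
rewrite cat_path last_cat last_block path_block; last by lia.
rewrite -jE pk lk.
by split=> //; congr pair; lia.
Qed.

Lemma mem_fan_cycle (x y : nat) : ((x, y) \in fan_cycle) = (x <= y < n + m).
Proof.
rewrite mem_cat mem_rot mem_spine //.
have -> : ((x, y) \in flatten [seq block j | j <- iota 1 m.-1])
    = [&& x <= y, n < y & y < n + m].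
  apply/flatten_mapP/and3P => [[j]|[le_xy lt_ny lt_ynm]].
    rewrite mem_iota => jm; rewrite mem_block; last by lia.
    by case/and4P.
  have om : 0 < owner (x, y) < m by rewrite /owner /=; case: ifP; lia.
  exists (owner (x, y)); first by rewrite mem_iota; lia.
  by rewrite mem_block // le_xy lt_ny lt_ynm eqxx.
by rewrite xpair_eqE; lia.
Qed.

Lemma uniq_fan_cycle : uniq fan_cycle.
Proof.
rewrite cat_uniq rot_uniq uniq_spine //= (uniq_flatten_map (f := owner)) ?iota_uniq //.
- rewrite andbT -all_predC; apply/allP => -[x y] /flatten_mapP[j].
  rewrite mem_iota => jm; rewrite mem_block; last by lia.
  case/and4P => _ lt_ny _ _.
  by rewrite /= mem_rot mem_spine // xpair_eqE; lia.
- by move=> j; rewrite mem_iota => jm; apply: uniq_block; lia.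
- move=> j; rewrite mem_iota => jm [x y]; rewrite mem_block; last by lia.
  by case/and4P => _ _ _ /eqP.
Qed.

Lemma cycle_fan_cycle : cycle (pair_adj n) fan_cycle.
Proof.
have [pb lb] := @path_blocks 1 m.-1 isT ltac:(lia).
have [N nE] : exists N, n = N.+2 by exists (n - 2); lia.
have n1E : n.-1 = N.+1 by lia.
have n1E' : n + 1 - 1 = n by lia.
have lbE : n + 1 + m.-1 - 1 = n + m.-1 by lia.
rewrite lbE n1E n1E' in pb lb.
have pN := @path_spine N ltac:(lia).
have lN := last_spine N (N, n).
(* Unfolding the top two rows exposes the entry that the rotation moves. *)
have spineE : spine n = [:: (N.+1, n), (N.+1, N.+1), (N, N.+1), (N, N), (N, n)
                           & spine N].
  have [n1 n2] : n - N.+1 = 1 /\ n - N = 2 by lia.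
  by rewrite [in LHS]nE /= n1 n2.
rewrite /fan_cycle spineE rot1_cons /= cat_rcons rcons_cat /= cat_path /= rcons_path.
rewrite pN pb lb; case: lN => ->; rewrite /pair_adj /code_adj /=; lia.
Qed.

End FanCycle.

(** The successor map is injective and sends [I] into [S]; a vertex [u] outside [I] that is also
    sent into [S] makes the inequality strict. *)
Lemma hamiltonian_independent_card (G : sgraph) (I S : {set G}) (v w : G) :
    hamiltonian G -> (forall x y, x \in I -> adj x y -> y \in S) ->
    [disjoint I & S] -> v \in I -> w \notin I :|: S ->
  #|I| < #|S|.
Proof.
case=> c [_ /andP[cyc_c uniq_c] c_all] adjIS dIS vI wR.
pose R := ~: (I :|: S).
have adj_next x : adj x (next c x) by apply: next_cycle.
(* The cycle visits [w] in [R] and [v] outside it, so it leaves [R] somewhere; otherwise membership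
   in [R] would propagate from [w] to [v]. *)
have [u uR nuR] : exists2 u, u \in R & next c u \notin R.
  apply/exists_inP; apply: contraT; rewrite negb_exists_in => /forall_inP Rnext.
  have cycR : cycle (fun x y => (x \in R) ==> (y \in R)) c.
    apply: sub_cycle (cycle_next uniq_c) => x y /eqP <-.
    by apply/implyP => /Rnext /negPn.
  have [i s rotE] := rot_to (c_all w).
  have /allP allR : all [in R] (rcons s w).
    rewrite -(rot_cycle i) rotE /= in cycR; have: w \in R by rewrite inE.
    move: (rcons s w) cycR => r.
    elim: r (w) => //= y r IHr x /andP[/implyP xy pr] /xy yR.
    by rewrite yR (IHr y).
  have := c_all v; rewrite -(mem_rot i) rotE -mem_rcons => /allR.
  by rewrite !inE vI.
(* A successor in [I] would, by symmetry of adjacency, put [u] in [S]. *)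
have nuS : next c u \in S.
  move: nuR; rewrite !inE negbK => /orP[nuI|//].
  move: uR; rewrite !inE => /norP[_ /negP[]].
  by apply: adjIS nuI _; rewrite adj_sym.
have uI : u \notin I by move: uR; rewrite !inE => /norP[].
have := cardsU1 u I; rewrite uI add1n => <-.
rewrite -(card_imset _ (can_inj (prev_next uniq_c))).
apply/subset_leq_card/subsetP => _ /imsetP[x xuI ->].
by move: xuI; rewrite !inE => /orP[/eqP->|/adjIS]; last exact.
Qed.

(** * Counting pairs in the fan graph: necessity *)

Section Fan.
Variables m n : nat.
Local Notation F := (fan_graph m n).
Local Notation M2F := (complete_double_vertex_graph F).

Definition outer_pairs : {set M2F} :=
  [set mpair (inl p.1 : F) (inl p.2) | p : 'I_m * 'I_m].

Definition mixed_pairs : {set M2F} :=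
  [set mpair (inl p.1 : F) (inr p.2) | p : 'I_m * 'I_n].

Lemma card_mixed_pairs : #|mixed_pairs| <= m * n.
Proof. by rewrite (leq_trans (leq_imset_card _ _)) // card_prod !card_ord. Qed.

(* [g] hits each pair twice: [{w_i, w_j}] from [(i, Some j)] and [(j, Some i)]
   when [i != j], and [{w_i, w_i}] from [(i, Some i)] and [(i, None)]. *)
Lemma card_outer_pairs : m * m.+1 <= 2 * #|outer_pairs|.
Proof.
pose g (p : 'I_m * option 'I_m) : M2F * bool :=
  if p.2 is Some j then (mpair (inl p.1 : F) (inl j), p.1 < j)
  else (mpair (inl p.1 : F) (inl p.1), true).
have g_inj : injective g.
  move=> [i oi] [j oj] E; have := congr1 snd E; have := congr1 fst E.
  rewrite /g /=; case: oi oj {E} => [i'|] [j'|] /= /mpair_inj + ltE.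
  - case=> -[[ij] [ij']]; rewrite ij ij' // in ltE *.
    (* In the swapped case the flags [j' < j] and [j < j'] agree, so both are false. *)
    have ->// : j = j' by apply: val_inj => /=; lia.
  - by case=> -[[ij] [ij']]; rewrite ij ij' ltnn in ltE.
  - by case=> -[[ij] [ij']]; rewrite -ij -ij' ltnn in ltE.
  - by case=> -[[->]].
have -> : m * m.+1 = #|[set g p | p : 'I_m * option 'I_m]|.
  by rewrite card_imset // card_prod card_option !card_ord.
rewrite mulnC -card_bool -cardsT -cardsX.
apply/subset_leq_card/subsetP => _ /imsetP[[i o] _ ->].
rewrite inE in_setT andbT; apply/imsetP.
by case: o => [j|]; [exists (i, j) | exists (i, i)].
Qed.

(** The additive form avoids truncated subtraction and, as [0 < m], also yields [2 <= n]. *)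
Lemma fan_hamiltonian_bound : 0 < m -> 0 < n -> hamiltonian M2F ->
  m + 2 <= 2 * n.
Proof.
move=> m_gt0 n_gt0 ham.
pose i0 := Ordinal m_gt0; pose a0 := Ordinal n_gt0.
have IS : #|outer_pairs| < #|mixed_pairs|.
  apply: (@hamiltonian_independent_card M2F outer_pairs mixed_pairs
            (mpair (inl i0 : F) (inl i0)) (mpair (inr a0 : F) (inr a0)) ham).
  - move=> _ B /imsetP[[i j] _ ->] /adj_mpairP[x [y [z [+ -> yz]]]] /=.
    have inlE : forall i' j' : 'I_m, x = inl i' -> y = inl j' -> mpair x z \in mixed_pairs.
      move=> i' j' -> yE; case: z yz => [k|a]; first by rewrite yE.
      by move=> _; apply/imsetP; exists (i', a).
    by case/mpair_inj => -[/esym xE /esym yE]; [apply: inlE xE yE | apply: inlE yE xE].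
  - rewrite -setI_eq0; apply/eqP/setP => A; rewrite !inE; apply/negP.
    by case/andP => /imsetP[p _ ->] /imsetP[q _] /mpair_inj[] [].
  - by apply/imsetP; exists (i0, i0).
  - rewrite inE; apply/norP.
    by split; apply/imsetP => -[p _] /mpair_inj[] [].
have := card_mixed_pairs; have := card_outer_pairs => leI leS.
have : m * m.+1 < m * (2 * n) by rewrite mulnCA; lia.
by rewrite ltn_pmul2l //; lia.
Qed.

(** * Transfer of the coded cycle to the graph: sufficiency *)

Section Coding.
Variables (i0 : 'I_m) (a0 : 'I_n).

(** [i0] and [a0] are [insubd] defaults, not reached when [x < n + m]. *)
Definition fan_vertex x : F :=
  if x < n then inr (insubd a0 x) else inl (insubd i0 (x - n)).

Definition fan_code (v : F) : nat :=
  match v with inl i => n + i | inr a => a end.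

Lemma fan_vertexK : {in gtn (n + m), cancel fan_vertex fan_code}.
Proof.
move=> x; rewrite inE /fan_vertex /= => lt_x.
by case: ltnP => lt_xn /=; rewrite val_insubd; case: ifP; lia.
Qed.

Lemma fan_codeK : cancel fan_code fan_vertex.
Proof.
case=> [i|a]; rewrite /fan_vertex /=.
  by rewrite ltnNge leq_addr addKn valKd.
by rewrite ltn_ord valKd.
Qed.

Lemma fan_code_lt v : fan_code v < n + m.
Proof. by case: v => i /=; have := ltn_ord i; lia. Qed.

Lemma adj_fan_code u v : @adj F u v = code_adj n (fan_code u) (fan_code v).
Proof.
rewrite /code_adj; case: u v => [i|a] [j|b] //=.
- by rewrite /edgeless_adj; lia.
- by have := ltn_ord b; lia.
- by have := ltn_ord a; lia.
- by rewrite /path_adj !ltn_ord /=; have := ltn_ord a; have := ltn_ord b; lia.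
Qed.

Definition pair_vertex (u : nat * nat) : M2F :=
  mpair (fan_vertex u.1) (fan_vertex u.2).

Lemma adj_pair_vertex :
  {in [pred u | u.1 <= u.2 < n + m] &,
    {homo pair_vertex : u v / pair_adj n u v >-> @adj M2F u v}}.
Proof.
move=> [x y] [x' y']; rewrite !inE /= => xy xy'.
have aE u v : u < n + m -> v < n + m -> code_adj n u v -> adj (fan_vertex u) (fan_vertex v).
  by move=> lu lv; rewrite adj_fan_code !fan_vertexK.
rewrite /pair_vertex /pair_adj /= => /or4P[] /andP[/eqP-> /aE adjP].
- by apply: adj_mpair; apply: adjP; lia.
- by rewrite (mpairC (fan_vertex x')); apply: adj_mpair; apply: adjP; lia.
- by rewrite (mpairC (fan_vertex x)); apply: adj_mpair; apply: adjP; lia.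
- rewrite (mpairC (fan_vertex x)) (mpairC (fan_vertex x')).
  by apply: adj_mpair; apply: adjP; lia.
Qed.

Lemma pair_vertex_inj :
  {in [pred u | u.1 <= u.2 < n + m] &, injective pair_vertex}.
Proof.
have vI u v : u < n + m -> v < n + m -> fan_vertex u = fan_vertex v -> u = v.
  by move=> lu lv /(congr1 fan_code); rewrite !fan_vertexK.
move=> [x y] [x' y']; rewrite !inE /= => xy xy' /mpair_inj /=.
(* A swapped match collapses because both codes are sorted. *)
by case=> -[/vI E1 /vI E2]; congr pair; lia.
Qed.

Lemma pair_vertexP (A : M2F) :
  exists2 u : nat * nat, u.1 <= u.2 < n + m & A = pair_vertex u.
Proof.
have [u [v ->]] := mpairP A; have := fan_code_lt u; have := fan_code_lt v.
case: (leqP (fan_code u) (fan_code v)) => [le_uv|lt_vu] lu lv.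
  by exists (fan_code u, fan_code v); rewrite /pair_vertex /= ?fan_codeK // le_uv.
exists (fan_code v, fan_code u); rewrite /= ?lv ?(ltnW lt_vu) //.
by rewrite /pair_vertex /= !fan_codeK mpairC.
Qed.

End Coding.

Lemma fan_hamiltonian : 1 < n -> 0 < m -> m <= 2 * (n - 1) -> hamiltonian M2F.
Proof.
move=> n_gt1 m_gt0 le_mn.
pose h := pair_vertex (Ordinal m_gt0) (Ordinal (ltnW n_gt1)).
pose c := fan_cycle n m.
have c_all : all [pred u | u.1 <= u.2 < n + m] c.
  by apply/allP => -[x y]; rewrite mem_fan_cycle.
have uniq_c : uniq c by apply: uniq_fan_cycle.
exists (map h c); split.
(* Three distinct codes, all in range since [1 < n], give length at least 3. *)
- rewrite size_map -[3]/(size [:: (0, 0); (0, 1); (1, 1)]).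
  apply: uniq_leq_size => // u; rewrite !inE.
  by case/or3P => /eqP->; rewrite mem_fan_cycle //; lia.
- rewrite /ucycle (homo_cycle_in (@adj_pair_vertex _ _)  c_all) ?cycle_fan_cycle //=.
  rewrite map_inj_in_uniq // => u v /(allP c_all) uc /(allP c_all) vc.
  exact: pair_vertex_inj.
- move=> A; have [[x y] xy ->] := pair_vertexP (Ordinal m_gt0) (Ordinal (ltnW n_gt1)) A.
  by apply: map_f; rewrite mem_fan_cycle.
Qed.

End Fan.

Theorem theorem1 (m n : nat) (hm : 1 <= m) (hn : 1 <= n) :
  hamiltonian (complete_double_vertex_graph (fan_graph m n)) <->
  (2 <= n /\ 1 <= m <= 2 * (n - 1)).
Proof.
split=> [/(fan_hamiltonian_bound hm hn) bound|[n_gt1 /andP[m_gt0 le_mn]]].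
  by lia.
exact: fan_hamiltonian.
Qed.
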